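(* Let $X$ be a reflexive Banach space with $1$-symmetric basis, let $1\le d_0\le d_1$ and let $\Omega$ be a bounded open subset of $\mathbb{R}^{d_1}$. Then $JF_X((0,1)^{d_0})$ is isometric to a complemented subspace of $JF_X(\Omega)$.
   Context: Let $X$ be a (infinite-dimensional, real) reflexive Banach space with norm $\|\cdot\|_X$ and a $1$-symmetric basis $(e_n)_{n}$, i.e. $\|\sum_n \epsilon_n a_n e_{\pi(n)}\|_X=\|\sum_n a_n e_n\|_X$ for all finitely supported real $(a_n)$, all signs $\epsilon_n\in\{-1,1\}$ and all permutations $\pi$ of $\mathbb{N}$. For a (nonempty) bounded open set $\Omega\subset\mathbb{R}^{d}$, $\mathcal{P}(\Omega)$ denotes the set of all open parallelepipeds $T=\prod_{i=1}^{d}(\alpha_i,\beta_i)$, $\alpha_i<\beta_i$, with $T\subset\Omega$. With $\mu$ Lebesgue measure, $JF_X(\Omega)$ is the completion of $L^1(\Omega)$ under the norm $\|f\|_{JF_X(\Omega)}=\sup\{\|\sum_{j=1}^m(\int_{T_j}f\,d\mu)e_j\|_X : m\in\mathbb{N},\ T_1,\dots,T_m\in\mathcal{P}(\Omega)\text{ pairwise disjoint}\}$. A subspace is complemented if it is the range of a bounded linear projection. *)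

(* Defs.v *)
From HB Require Import structures.
From mathcomp Require Import all_boot all_order all_algebra.
From mathcomp Require Import all_classical all_reals all_analysis.

Set Implicit Arguments.
Unset Strict Implicit.
Unset Printing Implicit Defensive.

Import Order.TTheory GRing.Theory Num.Theory.
Import numFieldNormedType.Exports.

Local Open Scope classical_set_scope.
Local Open Scope ring_scope.

Definition rV_display : measure_display.
Proof. exact: default_measure_display. Qed.

Section measurable_rV.
Context {R : realType} (n : nat).

Definition rV_coord (i : 'I_n) (v : 'rV[R]_n) : measurableTypeR R := v ord0 i.

Let rV_set0 : g_sigma_preimage rV_coord set0.
Proof. exact: sigma_algebra0. Qed.

Let rV_setC A : g_sigma_preimage rV_coord A -> g_sigma_preimage rV_coord (~` A).
Proof. exact: sigma_algebraC. Qed.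

Let rV_bigcup (F : (set 'rV[R]_n)^nat) :
  (forall i, g_sigma_preimage rV_coord (F i)) ->
  g_sigma_preimage rV_coord (\bigcup_i (F i)).
Proof. exact: sigma_algebra_bigcup. Qed.

(* The product of the Borel sigma-algebras of the coordinates; it is the Borel
   sigma-algebra of R^n because R is second countable. *)
HB.instance Definition _ := @isMeasurable.Build rV_display
  'rV[R]_n (g_sigma_preimage rV_coord) rV_set0 rV_setC rV_bigcup.

Lemma measurable_rV_coord (i : 'I_n) :
  measurable_fun [set: 'rV[R]_n] (rV_coord i).
Proof.
move=> _ Y mY; rewrite setTI; apply: sub_sigma_algebra => /=.
rewrite -bigcup_seq/=; exists i => /=; first by rewrite mem_index_enum.
by exists Y => //; rewrite setTI.
Qed.

Lemma measurable_fun_rVP d (T : measurableType d) (f : T -> 'rV[R]_n) :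
  (forall i, measurable_fun [set: T] (rV_coord i \o f)) ->
  measurable_fun [set: T] f.
Proof.
move=> mf.
suff h : g_sigma_preimage (fun i => rV_coord i \o f) `<=` measurable.
  move=> _ A mA; apply: h; rewrite g_sigma_preimage_comp.
  by exists A.
apply: smallest_sub; first exact: sigma_algebra_measurable.
rewrite -bigcup_seq; apply: bigcup_sub => i _ A [B mB <-]; exact: mf.
Qed.

End measurable_rV.

Section lebesgue_rV.
Context {R : realType}.

Definition rV_cons n (p : measurableTypeR R * 'rV[R]_n) : 'rV[R]_n.+1 :=
  \row_i if unlift ord0 i is Some j then p.2 ord0 j else p.1.

Definition rV_uncons n (v : 'rV[R]_n.+1) : measurableTypeR R * 'rV[R]_n :=
  (v ord0 ord0, \row_j v ord0 (lift ord0 j)).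

Lemma rV_consK n : cancel (@rV_cons n) (@rV_uncons n).
Proof.
move=> [x v]; rewrite /rV_uncons /rV_cons mxE unlift_none/=; congr pair.
by apply/rowP => j; rewrite !mxE liftK.
Qed.

Lemma rV_unconsK n : cancel (@rV_uncons n) (@rV_cons n).
Proof.
move=> v; apply/rowP => i; rewrite /rV_cons mxE/=.
by case: unliftP => [j|] ->//; rewrite mxE.
Qed.

Lemma measurable_rV_cons n : measurable_fun setT (@rV_cons n).
Proof.
apply: measurable_fun_rVP => i.
have [j ij|i0] := unliftP ord0 i.
  rewrite (_ : _ \o _ = rV_coord j \o snd).
    by apply: measurableT_comp => //; exact: measurable_rV_coord.
  by apply/funext => -[x v]; rewrite /= /rV_coord/= mxE ij liftK.
rewrite (_ : _ \o _ = fst)//.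
by apply/funext => -[x v]; rewrite /= /rV_coord/= mxE i0 unlift_none.
Qed.

Lemma measurable_rV_uncons n : measurable_fun setT (@rV_uncons n).
Proof.
apply: measurable_fun_pair; first exact: (measurable_rV_coord ord0).
apply: measurable_fun_rVP => i.
rewrite (_ : _ \o _ = rV_coord (lift ord0 i)); first exact: measurable_rV_coord.
by apply/funext => v; rewrite /= /rV_coord mxE.
Qed.

Section lebesgue_rV_cons.
Context n (mu : {sigma_finite_measure set 'rV[R]_n -> \bar R}).

Definition lebesgue_rV_cons : set 'rV[R]_n.+1 -> \bar R :=
  pushforward (lebesgue_measure \x mu)%E (@rV_cons n).

HB.instance Definition _ := Measure.copy lebesgue_rV_cons
  (measure_function_pushforward__canonical__measure_function_Measure
    (lebesgue_measure \x mu)%E (@measurable_rV_cons n)).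

Let lebesgue_rV_cons_sigma_finite : sigma_finite setT lebesgue_rV_cons.
Proof.
have /sigma_finiteP[F [TF ndF Foo]] := sigma_finiteT (@lebesgue_measure R).
have /sigma_finiteP[G [TG ndG Goo]] := sigma_finiteT mu.
exists (fun k => @rV_uncons n @^-1` (F k `*` G k)).
  rewrite -preimage_bigcup [X in _ @^-1` X](_ : _ = setT) ?preimage_setT//.
  rewrite -subTset => -[x v] _.
  have [i _ Fix] : (\bigcup_k F k) x by rewrite -TF.
  have [j _ Gjv] : (\bigcup_k G k) v by rewrite -TG.
  exists (maxn i j) => //; split.
    by move: x Fix; exact/subsetPset/ndF/leq_maxl.
  by move: v Gjv; exact/subsetPset/ndG/leq_maxr.
move=> k; have [mF Fk] := Foo k; have [mG Gk] := Goo k; split.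
  rewrite -[X in measurable X]setTI.
  by apply: measurable_rV_uncons => //; exact: measurableX.
rewrite /lebesgue_rV_cons /pushforward -comp_preimage.
rewrite (_ : _ \o _ = id); last by apply/funext => p; rewrite /= rV_consK.
by rewrite preimage_id product_measure1E// lte_mul_pinfty// ge0_fin_numE.
Qed.

HB.instance Definition _ := Measure_isSigmaFinite.Build _ _ _
  lebesgue_rV_cons lebesgue_rV_cons_sigma_finite.

End lebesgue_rV_cons.

Fixpoint lebesgue_rV n : {sigma_finite_measure set 'rV[R]_n -> \bar R} :=
  match n with
  | 0 => \d_(0 : 'rV[R]_0)
  | n'.+1 => lebesgue_rV_cons (lebesgue_rV n')
  end.

Definition open_box n (a b : 'rV[R]_n) : set 'rV[R]_n :=
  [set x | forall i, a ord0 i < x ord0 i < b ord0 i].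

Lemma measurable_open_box n (a b : 'rV[R]_n) : measurable (open_box a b).
Proof.
rewrite (_ : open_box a b =
    \bigcap_(i in [set: 'I_n]) (rV_coord i @^-1` `]a ord0 i, b ord0 i[)).
  apply: fin_bigcap_measurable => // i _; rewrite -[X in measurable X]setTI.
  exact: measurable_rV_coord.
apply/seteqP; split => x /= H i; first by move=> _; rewrite /= in_itv; exact: H.
by have := H i Logic.I; rewrite /= in_itv.
Qed.

Lemma lebesgue_rV_open_box n (a b : 'rV[R]_n) :
  (forall i, a ord0 i <= b ord0 i) ->
  lebesgue_rV n (open_box a b) = (\prod_i (b ord0 i - a ord0 i))%:E.
Proof.
elim: n a b => [|n IH] a b ab.
  rewrite big_ord0 /= diracE (_ : _ \in _ = true)//.
  by apply/mem_set => -[].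
rewrite /= /lebesgue_rV_cons /pushforward.
pose tl (v : 'rV[R]_n.+1) := (rV_uncons v).2.
rewrite (_ : _ @^-1` _ =
    `]a ord0 ord0, b ord0 ord0[%classic `*` open_box (tl a) (tl b)).
  rewrite product_measure1E//; last exact: measurable_open_box.
  rewrite IH; last by move=> i; rewrite !mxE.
  rewrite [X in (X * _)%E]lebesgue_measure_itv/= lte_fin big_ord_recl.
  under eq_bigr do rewrite !mxE.
  case: ltP => [_|ba]; first by rewrite -EFinB -EFinM.
  have -> : b ord0 ord0 = a ord0 ord0 by apply/eqP; rewrite eq_le ba ab.
  by rewrite subrr mul0r mul0e.
apply/seteqP; split => [[x v]/= H|[x v]/= [H1 H2] i].
  split; first by have := H ord0; rewrite /= mxE unlift_none in_itv.
  by move=> i; have := H (lift ord0 i); rewrite !mxE liftK.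
rewrite mxE; case: unliftP => [j|] ->/=; last by move: H1; rewrite in_itv.
by have := H2 j; rewrite !mxE.
Qed.

End lebesgue_rV.

Section banach.
Context {R : realType}.

Definition in_dual (X : normedModType R) (f : X -> R) : Prop :=
  scalar f /\ continuous f.

Definition dual_norm (X : normedModType R) (f : X -> R) : R :=
  sup [set `|f x| | x in [set x : X | `|x| <= 1]].

(* Every bounded linear functional Phi on the normed dual of X is the
   evaluation at a point of X; the values of Phi outside the dual are
   irrelevant. *)
Definition reflexive_space (X : normedModType R) : Prop :=
  forall Phi : (X -> R) -> R,
    (forall (a : R) (f g : X -> R), in_dual f -> in_dual g ->
      Phi (fun x => a * f x + g x) = a * Phi f + Phi g) ->
    (exists C : R, forall f, in_dual f -> `|Phi f| <= C * dual_norm f) ->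
  exists x : X, forall f, in_dual f -> Phi f = f x.

Definition schauder_basis (X : normedModType R) (e : nat -> X) : Prop :=
  forall x : X, exists! a : nat -> R,
    (fun N => \sum_(k < N) a k *: e k) @ \oo --> x.

Definition one_symmetric (X : normedModType R) (e : nat -> X) : Prop :=
  forall (N : nat) (a eps : nat -> R) (pi : nat -> nat),
    (forall k, eps k = 1 \/ eps k = -1) -> bijective pi ->
    `|\sum_(k < N) (eps k * a k) *: e (pi k)| = `|\sum_(k < N) a k *: e k|.

Definition one_symmetric_basis (X : normedModType R) (e : nat -> X) : Prop :=
  schauder_basis e /\ one_symmetric e.

Definition isometric_to_complemented (V W : normedModType R) : Prop :=
  exists (T : {linear V -> W}) (P : {linear W -> W}),
    [/\ forall v, `|T v| = `|v|,
        exists C : R, forall w, `|P w| <= C * `|w|,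
        forall w, P (P w) = P w &
        range P = range T].

End banach.

Section JF.
Context {R : realType} (X : completeNormedModType R) (e : nat -> X).

Definition unit_cube n : set 'rV[R]_n := [set x | forall i, 0 < x ord0 i < 1].

Definition parallelepipeds n (Om : set 'rV[R]_n) : set (set 'rV[R]_n) :=
  [set T | exists a b : 'rV[R]_n,
    [/\ forall i, a ord0 i < b ord0 i, T = open_box a b & T `<=` Om]].

Definition L1 n (Om : set 'rV[R]_n) : set ('rV[R]_n -> R) :=
  [set f | (lebesgue_rV n).-integrable Om (EFin \o f)].

(* The set below is bounded for f in L1 Om, so that sup is a genuine supremum
   there. *)
Definition JF_norm n (Om : set 'rV[R]_n) (f : 'rV[R]_n -> R) : R :=
  sup [set r | exists (m : nat) (T : 'I_m -> set 'rV[R]_n),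
    [/\ forall j, parallelepipeds Om (T j),
        trivIset [set: 'I_m] T &
        r = `|\sum_(j < m) (\int[lebesgue_rV n]_(x in T j) f x) *: e j| ]].

(* J is a completion of (L1 Om, JF_norm): a Banach space with a linear
   norm-preserving map iota from L1 Om onto a dense subspace. Functions in
   L1 Om that are a.e. equal have the same image, since the JF_norm of their
   difference is 0. *)
Definition is_JF n (Om : set 'rV[R]_n) (J : completeNormedModType R) : Prop :=
  exists iota : ('rV[R]_n -> R) -> J,
    [/\ forall (a : R) f g, L1 Om f -> L1 Om g ->
          iota (fun x => a * f x + g x) = a *: iota f + iota g,
        forall f, L1 Om f -> `|iota f| = JF_norm Om f &
        dense (iota @` L1 Om)].

End JF.

(* Main.v *)
(* Fix a cube [Q] of side [s] contained in [Om], write points of R^d1 as pairs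
   (x, y) with x in R^d0, and let [pi] be the projection (x, y) |-> x, rescaled
   to map [Q] onto the unit cube.  Embed f as [s ^- d1 * f (pi z)] on [Q] and 0
   elsewhere; in the other direction integrate F over the fibers of [pi] in [Q].
   Fiber integration is a left inverse of the embedding, and it is a contraction
   since a disjoint family of boxes of the unit cube lifts to a disjoint family
   of boxes of [Q].  The embedding is a contraction as well: the integral of the
   embedded f over a box T' x U is the integral of f over (the rescaled) T'
   times the relative volume of U, so the vector of the integrals over disjoint
   boxes T'_j x U_j is the average over y of the vectors of the integrals over
   the T'_j with y in U_j, and these T'_j are disjoint.  Both maps extend to
   the completions by density. *)
Require Import Defs.
From HB Require Import structures.
From mathcomp Require Import all_boot all_order all_algebra.
From mathcomp Require Import all_classical all_reals all_analysis.
From mathcomp Require Import measurable_realfun.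
Import numFieldNormedType.Exports.
Local Open Scope classical_set_scope.
Local Open Scope ring_scope.
Import Order.TTheory GRing.Theory Num.Theory.

Set Implicit Arguments.
Unset Strict Implicit.
Unset Printing Implicit Defensive.

(** * Boxes and Lebesgue measure *)

Section boxes.
Context {R : realType}.

(** Truncating each side at 0 gives an empty box volume 0, so the volume formula holds for arbitrary
    corners, in particular for those of an intersection. *)
Definition box_vol n (a b : 'rV[R]_n) : R :=
  \prod_i Num.max 0 (b ord0 i - a ord0 i).

Lemma box_vol_ge0 n (a b : 'rV[R]_n) : 0 <= box_vol a b.
Proof. by apply: prodr_ge0 => i _; rewrite le_max lexx. Qed.

Lemma open_box_eq0 n (a b : 'rV[R]_n) (i : 'I_n) :
  b ord0 i <= a ord0 i -> open_box a b = set0.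
Proof.
move=> ba; rewrite -subset0 => x /(_ i)/andP[ax xb].
by have := lt_trans ax xb; rewrite ltNge ba.
Qed.

Lemma lebesgue_rV_box_vol n (a b : 'rV[R]_n) :
  lebesgue_rV n (open_box a b) = (box_vol a b)%:E.
Proof.
have [[i ba]|ab] := pselect (exists i, b ord0 i <= a ord0 i).
  rewrite (open_box_eq0 ba) measure0 /box_vol (bigD1 i)//= max_l ?mul0r//.
  by rewrite subr_le0.
have {}ab i : a ord0 i <= b ord0 i.
  by rewrite leNgt; apply/negP => /ltW ?; apply: ab; exists i.
rewrite lebesgue_rV_open_box// /box_vol; congr (_%:E).
by apply: eq_bigr => i _; rewrite max_r// subr_ge0.
Qed.

Lemma open_boxI n (a b u v : 'rV[R]_n) :
  open_box a b `&` open_box u v =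
  open_box (map2_mx Num.max a u) (map2_mx Num.min b v).
Proof.
apply/seteqP; split=> [x [xab xuv] i|x xI].
  have /andP[x1 x2] := xab i; have /andP[x3 x4] := xuv i.
  by rewrite !mxE gt_max lt_min x1 x2 x3 x4.
split=> i; have := xI i; rewrite !mxE gt_max lt_min;
  move=> /andP[/andP[x1 x2] /andP[x3 x4]].
  by rewrite x1 x3.
by rewrite x2 x4.
Qed.

Definition open_boxes n : set (set 'rV[R]_n) :=
  [set A | exists a b, A = open_box a b].

Lemma open_boxes_cover n :
  \bigcup_k open_box (const_mx (- k%:R)) (const_mx k%:R) = [set: 'rV[R]_n].
Proof.
rewrite -subTset => x _; exists (Num.bound `|x|) => //= i.
rewrite !mxE -ltr_norml; apply: le_lt_trans (archi_boundP _) => //.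
rewrite [leRHS]/Num.norm/= mx_normrE.
by apply/bigmax_geP; right; exists (ord0, i).
Qed.

(** The preimage of a ray []x, +oo[] under the coordinate [i] is a countable union of boxes with
    lower bound [x] in direction [i] and all other bounds tending to infinity. *)
Lemma measurable_open_boxes n :
  @measurable _ ('rV[R]_n : measurableType _) = <<s @open_boxes n >>.
Proof.
apply/seteqP; split; last first.
  apply: smallest_sub; first exact: sigma_algebra_measurable.
  by move=> _ [a [b ->]]; exact: measurable_open_box.
apply: smallest_sub; first exact: smallest_sigma_algebra.
rewrite -bigcup_seq; apply: bigcup_sub => i _.
suff : measurable_fun setT
    (@rV_coord R n i : g_sigma_algebraType (@open_boxes n) -> measurableTypeR R).
  by move=> mi _ [B mB <-]; exact: mi.
apply: (measurability _ (RGenOInfty.measurableE R)) => _ [_ [x ->] <-].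
rewrite setTI (_ : _ @^-1` _ = \bigcup_k open_box
    (\row_j if j == i then x else - k%:R) (const_mx k%:R)).
  by apply: bigcupT_measurable => k; apply: sub_sigma_algebra; do 2 eexists.
apply/seteqP; split => [v|v [k _ /(_ i)]]; last first.
  by rewrite !mxE eqxx /rV_coord /= in_itv/= andbT => /andP[].
rewrite /rV_coord /= in_itv/= andbT => xv.
have [k _ vk] : (\bigcup_k open_box (const_mx (- k%:R)) (const_mx k%:R)) v.
  by rewrite open_boxes_cover.
exists k => // j; have := vk j; rewrite !mxE => /andP[v1 ->].
by rewrite andbT; case: eqP => // ->.
Qed.

(** Boxes are stable under intersection, generate the sigma-algebra, and include cubes of finite
    measure exhausting the space; hence uniqueness of measures applies. *)
Lemma open_box_measure_unique n (m1 m2 : {measure set 'rV[R]_n -> \bar R}) :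
  (forall a b, m1 (open_box a b) = m2 (open_box a b)) ->
  (forall a b, (m1 (open_box a b) < +oo)%E) ->
  forall A, measurable A -> m1 A = m2 A.
Proof.
move=> m12 m1oo; apply: (measure_unique (@open_boxes n)
  (fun k => open_box (const_mx (- k%:R)) (const_mx k%:R))) => //.
- exact: measurable_open_boxes.
- by move=> _ _ [a [b ->]] [u [v ->]]; rewrite open_boxI; do 2 eexists.
- by move=> k; do 2 eexists.
- exact: open_boxes_cover.
- by move=> _ [a [b ->]].
Qed.

(** An open set is the union of the countably many boxes with rational corners that it contains. *)
Lemma open_rV_measurable n (Om : set 'rV[R]_n) : open Om -> measurable Om.
Proof.
move=> oOm; pose I : Type := ('rV[rat]_n * 'rV[rat]_n)%type.
pose rbox (p : I) := open_box (map_mx (@ratr R) p.1) (map_mx (@ratr R) p.2).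
rewrite (_ : Om = \bigcup_p (if `[< rbox p `<=` Om >] then rbox p else set0)).
  apply: countable_bigcupT_measurable => [|p]; first exact: countableP.
  by case: ifP => _ //; exact: measurable_open_box.
apply/seteqP; split=> [x Omx|x [p _]]; last by case: asboolP => // + ?; exact.
have /nbhs_ballP[r r0 rOm] : nbhs x Om by exact: open_nbhs_nbhs.
have r1 (i : 'I_n) : x ord0 i - r < x ord0 i by rewrite ltrBlDr ltrDl.
have r2 (i : 'I_n) : x ord0 i < x ord0 i + r by rewrite ltrDl.
(* Rational corners within [r] of [x] on either side: the box contains [x] and stays in the ball. *)
pose p : I := (\row_i sval (cid (rat_in_itvoo (r1 i))),
               \row_i sval (cid (rat_in_itvoo (r2 i)))).
have p1 i : x ord0 i - r < ratr (p.1 ord0 i) < x ord0 i.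
  by rewrite mxE; case: cid => q /=; rewrite in_itv.
have p2 i : x ord0 i < ratr (p.2 ord0 i) < x ord0 i + r.
  by rewrite mxE; case: cid => q /=; rewrite in_itv.
exists p => //; rewrite ifT; last first.
  apply/asboolP => y yp; apply: rOm; split=> // i j; rewrite !ord1 /ball/=.
  have := yp j; rewrite !mxE => /andP[y1 y2].
  have := p1 j; have := p2 j; rewrite !mxE => /andP[_ q2] /andP[q1 _].
  rewrite distrC ltr_distl.
  rewrite (lt_trans q1) 1?(lt_trans y2)//.
move=> i; have := p1 i; have := p2 i; rewrite !mxE => /andP[x2 _] /andP[_ x1].
by rewrite x1 x2.
Qed.

End boxes.

(** * The projection onto the first coordinates *)

Section base_proj.
Context {R : realType} (n k : nat) (q : 'rV[R]_(n + k)) (s : R).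
Hypothesis s_gt0 : 0 < s.

(** It is increasing in each coordinate it keeps, so applying it to the corners of a nonempty box
    gives the corners of the projected box. *)
Definition base_proj (z : 'rV[R]_(n + k)) : 'rV[R]_n :=
  s^-1 *: (lsubmx z - lsubmx q).

Lemma measurable_base_proj : measurable_fun setT base_proj.
Proof.
apply: measurable_fun_rVP => i; rewrite (_ : _ \o _ =
    (fun z => s^-1 * (rV_coord (lshift k i) z - q ord0 (lshift k i)))).
  apply: measurable_funM => //; apply: measurable_funB => //.
  exact: measurable_rV_coord.
by apply/funext => z; rewrite /= /rV_coord !mxE.
Qed.

Lemma base_projK x y : base_proj (row_mx (lsubmx q + s *: x) y) = x.
Proof.
by rewrite /base_proj row_mxKl addrC addKr scalerA mulVf ?scale1r// gt_eqF.
Qed.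

(** The preimage constrains only the first [n] coordinates, to lie between [q + s a] and [q + s b];
    cutting by a box therefore leaves a box. *)
Lemma base_proj_open_box (a b : 'rV[R]_n) (u v : 'rV[R]_(n + k)) :
  base_proj @^-1` open_box a b `&` open_box u v = open_box
    (row_mx (map2_mx Num.max (lsubmx q + s *: a) (lsubmx u)) (rsubmx u))
    (row_mx (map2_mx Num.min (lsubmx q + s *: b) (lsubmx v)) (rsubmx v)).
Proof.
have E z i : (a ord0 i < base_proj z ord0 i < b ord0 i) =
    ((lsubmx q + s *: a) ord0 i < z ord0 (lshift k i) < (lsubmx q + s *: b) ord0 i).
  by rewrite !mxE mulrC ltr_pdivlMr// ltr_pdivrMr// ltrBrDl ltrBlDl !(mulrC _ s).
apply/seteqP; split=> [z [zab zuv] i|z zI].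
  case: (splitP i) => j ij.
    have -> : i = lshift k j by exact: val_inj.
    have /andP[z1 z2] := zuv (lshift k j).
    have := zab j; rewrite E => /andP[z3 z4].
    rewrite !row_mxEl !mxE gt_max lt_min z1 z2; move: z3 z4.
    by rewrite !mxE => -> ->.
  have -> : i = rshift n j by exact: val_inj.
  by rewrite !row_mxEr !mxE; exact: zuv.
split=> [i|i].
  rewrite E; have := zI (lshift k i); rewrite !row_mxEl !mxE gt_max lt_min.
  by move=> /andP[/andP[z1 _] /andP[z2 _]]; rewrite z1 z2.
have := zI i; case: (splitP i) => j ij.
  have -> : i = lshift k j by exact: val_inj.
  rewrite !row_mxEl !mxE gt_max lt_min.
  by move=> /andP[/andP[_ z1] /andP[_ z2]]; rewrite z1 z2.
have -> : i = rshift n j by exact: val_inj.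
by rewrite !row_mxEr !mxE.
Qed.

(** The density of the image under the projection of Lebesgue measure on the box: [s ^+ n] comes
    from the rescaling, the rest is the volume of the fiber. *)
Definition slab_vol (u v : 'rV[R]_(n + k)) : R :=
  s ^+ n * box_vol (rsubmx u) (rsubmx v).

Lemma slab_vol_ge0 u v : 0 <= slab_vol u v.
Proof. by rewrite mulr_ge0 ?box_vol_ge0// exprn_ge0// ltW. Qed.

(** Both sides are measures in [A], finite on boxes, so it suffices to compare them on boxes, where
    both are explicit products. *)
Lemma lebesgue_rV_base_proj (u v : 'rV[R]_(n + k)) (A : set 'rV[R]_n) :
  measurable A ->
  lebesgue_rV (n + k) (base_proj @^-1` A `&` open_box u v) =
  ((slab_vol u v)%:E *
   lebesgue_rV n (A `&` open_box (base_proj u) (base_proj v)))%E.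
Proof.
move: A; have mB := measurable_open_box (base_proj u) (base_proj v).
have mD := measurable_open_box u v.
pose m1 : {measure set _ -> \bar R} :=
  measure_function_pushforward__canonical__measure_function_Measure
    (mrestr (lebesgue_rV (n + k)) mD) measurable_base_proj.
pose m2 : {measure set _ -> \bar R} :=
  mscale (NngNum (slab_vol_ge0 u v)) (mrestr (lebesgue_rV n) mB).
move=> A mA; change (m1 A = m2 A).
apply: open_box_measure_unique mA => [a b|a b].
  rewrite /m1 /m2 /= /pushforward /mscale/= /mrestr/= base_proj_open_box.
  rewrite open_boxI !lebesgue_rV_box_vol -EFinM /slab_vol; congr (_%:E).
  rewrite {1}/box_vol big_split_ord/= mulrAC; congr (_ * _); last first.
    by apply: eq_bigr => i _; rewrite !row_mxEr.
  rewrite -[n in s ^+ n]card_ord -prodr_const -big_split/=.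
  apply: eq_bigr => i _; rewrite !row_mxEl !mxE; set c := q _ _.
  (* Writing the corners in rescaled form lets [s] factor out of the maximum and the minimum. *)
  have sK x : x = c + s * (s^-1 * (x - c)).
    by rewrite mulrA divff ?mul1r ?gt_eqF// addrC subrK.
  rewrite {1}[u _ _]sK {1}[v _ _]sK -addr_maxr -addr_minr.
  rewrite -maxr_pMr ?ltW// -minr_pMr ?ltW// [_ + s * _]addrC addrKA -mulrBr.
  by rewrite maxr_pMr ?ltW// mulr0.
rewrite /m1 /= /pushforward /mrestr/= base_proj_open_box.
by rewrite lebesgue_rV_box_vol ltry.
Qed.

End base_proj.

(** The complement of [D] is null for the restricted measure, and on subsets of [A] inside [D] the
    two measures agree. *)
Lemma ge0_integral_mrestr d (T : measurableType d) (R : realType)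
    (mu : {measure set T -> \bar R}) (D A : set T) (mD : measurable D)
    (f : T -> \bar R) :
  measurable A -> measurable_fun setT f -> (forall x, (0 <= f x)%E) ->
  (\int[mrestr mu mD]_(x in A) f x = \int[mu]_(x in A `&` D) f x)%E.
Proof.
move=> mA mf f0; rewrite (@ge0_negligible_integral _ _ _ _ A (~` D))//.
- rewrite setDE setCK; apply: eq_measure_integral => B mB BAD.
  by rewrite /= /mrestr setIidl// => x /BAD[].
- exact: measurableC.
- exact: measurable_funTS.
- by rewrite /= /mrestr setICl measure0.
Qed.

(** * Change of variables along the projection, and the embedding of functions *)

Section base_proj_integral.
Context {R : realType} (n k : nat) (q : 'rV[R]_(n + k)) (s : R).
Hypothesis s_gt0 : 0 < s.
Local Notation pi := (base_proj q s).

(** Both sides become integrals of [f] over [A] against the two measures identified by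
    [lebesgue_rV_base_proj]. *)
Lemma ge0_integral_base_proj (u v : 'rV[R]_(n + k)) (A : set 'rV[R]_n)
    (f : 'rV[R]_n -> \bar R) :
  measurable A -> measurable_fun setT f -> (forall x, (0 <= f x)%E) ->
  (\int[lebesgue_rV (n + k)]_(z in pi @^-1` A `&` open_box u v) f (pi z) =
   (slab_vol s u v)%:E *
   \int[lebesgue_rV n]_(x in A `&` open_box (pi u) (pi v)) f x)%E.
Proof.
move=> mA mf f0.
have mpi := measurable_base_proj q s.
have mD := measurable_open_box u v.
have mB := measurable_open_box (pi u) (pi v).
have mpiA : measurable (pi @^-1` A).
  by rewrite -[X in measurable X]setTI; exact: mpi.
rewrite -(@ge0_integral_mrestr _ _ _ _ _ _ mD (f \o pi))//; last 2 first.
- exact: (measurableT_comp mf mpi).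
- by move=> z; exact: f0.
rewrite -ge0_integral_pushforward//; last exact: measurable_funTS.
rewrite -(@ge0_integral_mrestr _ _ _ _ _ _ mB f)//.
have sl := slab_vol_ge0 s_gt0 u v.
rewrite -[slab_vol s u v]/((NngNum sl)%:num) -ge0_integral_mscale//; last first.
  exact: measurable_funTS.
apply: eq_measure_integral => C mC _.
exact: lebesgue_rV_base_proj.
Qed.

Lemma integral_base_proj (u v : 'rV[R]_(n + k)) (A : set 'rV[R]_n)
    (f : 'rV[R]_n -> \bar R) :
  measurable A -> (lebesgue_rV n).-integrable setT f ->
  (\int[lebesgue_rV (n + k)]_(z in pi @^-1` A `&` open_box u v) f (pi z) =
   (slab_vol s u v)%:E *
   \int[lebesgue_rV n]_(x in A `&` open_box (pi u) (pi v)) f x)%E.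
Proof.
move=> mA intf; have mf := measurable_int _ intf.
have mAB : measurable (A `&` open_box (pi u) (pi v)).
  by apply: measurableI => //; exact: measurable_open_box.
have intfA : (lebesgue_rV n).-integrable (A `&` open_box (pi u) (pi v)) f.
  exact: integrableS intf.
rewrite integralE [in RHS]integralE muleBr//; last first.
  exact/fin_num_adde_defr/integrable_pos_fin_num.
congr (_ - _)%E.
  rewrite -[RHS]ge0_integral_base_proj//; last exact: measurable_funepos.
  by apply: eq_integral => z _; rewrite !funeposE.
rewrite -[RHS]ge0_integral_base_proj//; last exact: measurable_funeneg.
by apply: eq_integral => z _; rewrite !funenegE.
Qed.

Lemma integrable_base_proj (u v : 'rV[R]_(n + k)) (f : 'rV[R]_n -> \bar R) :
  (lebesgue_rV n).-integrable setT f ->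
  (lebesgue_rV (n + k)).-integrable (open_box u v) (f \o pi).
Proof.
move=> intf; have mf := measurable_int _ intf; apply/integrableP; split.
  by apply: measurable_funTS; apply: measurableT_comp; last exact: measurable_base_proj.
have mabsf : measurable_fun setT (abse \o f) by exact: measurableT_comp.
have := ge0_integral_base_proj u v measurableT mabsf (fun=> abse_ge0 _).
rewrite preimage_setT setTI => ->.
have /integrableP[_] : (lebesgue_rV n).-integrable (setT `&` open_box (pi u) (pi v)) f.
  apply: integrableS intf => //; apply: measurableI => //.
  exact: measurable_open_box.
by apply: lte_mul_pinfty; rewrite ?lee_fin ?slab_vol_ge0.
Qed.

(** The factor is the inverse volume of the cube at [q], so that integrating over the fibers gives
    [f] back. Extending [f] by 0 off the unit cube makes it integrable on the whole space. *)
Definition embed (f : 'rV[R]_n -> R) : 'rV[R]_(n + k) -> R :=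
  fun z => s ^- (n + k) *
    (((f \_ @unit_cube R n) \o pi) \_ (open_box q (q + const_mx s))) z.

Lemma unit_cubeE : @unit_cube R n = open_box 0 (const_mx 1).
Proof. by apply/seteqP; split => x xc i; have := xc i; rewrite !mxE. Qed.

Lemma measurable_unit_cube : measurable (@unit_cube R n).
Proof. by rewrite unit_cubeE; exact: measurable_open_box. Qed.

Let integrable_unit_cube f : L1 (@unit_cube R n) f ->
  (lebesgue_rV n).-integrable setT (EFin \o (f \_ (@unit_cube R n))).
Proof.
move=> Lf; rewrite -restrict_EFin.
exact: (integrable_mkcond _ measurable_unit_cube).1 Lf.
Qed.

Lemma embed_lin (a : R) f g :
  embed (fun x => a * f x + g x) = (fun z => a * embed f z + embed g z).
Proof.
apply/funext => z; rewrite /embed /patch/=.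
by case: ifP => _; [case: ifP => _|]; rewrite ?mulr0 ?addr0// mulrDr mulrCA.
Qed.

Lemma L1_embed (Om : set 'rV[R]_(n + k)) f : measurable Om ->
  L1 (@unit_cube R n) f -> L1 Om (embed f).
Proof.
move=> mOm /integrable_unit_cube intf; rewrite /L1/= /embed.
apply: (@integrableZl _ _ _ _ _ mOm (s ^- (n + k))
  (EFin \o ((f \_ (@unit_cube R n) \o pi) \_ (open_box q (q + const_mx s))))).
rewrite -restrict_EFin.
apply/integrable_restrict => //; first exact: measurable_open_box.
apply: integrableS (integrable_base_proj q (q + const_mx s) intf) => //.
- exact: measurable_open_box.
- by apply: measurableI => //; exact: measurable_open_box.
Qed.

(** The factor [s ^+ n] of [slab_vol] cancels against the normalization, leaving the volume of the
    fiber of the box relative to [s ^+ k]. *)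
Lemma integral_embed (u v : 'rV[R]_(n + k)) (A : set 'rV[R]_n) f :
  measurable A -> L1 (@unit_cube R n) f ->
  open_box u v `<=` open_box q (q + const_mx s) ->
  \int[lebesgue_rV (n + k)]_(z in pi @^-1` A `&` open_box u v) embed f z =
  (box_vol (rsubmx u) (rsubmx v) / s ^+ k) *
  \int[lebesgue_rV n]_(x in A `&` open_box (pi u) (pi v) `&` @unit_cube R n) f x.
Proof.
move=> mA /integrable_unit_cube intf uvQ.
have mP : measurable (pi @^-1` A `&` open_box u v).
  apply: measurableI; last exact: measurable_open_box.
  by rewrite -[X in measurable X]setTI; exact: measurable_base_proj.
rewrite (@eq_Rintegral _ _ _ _ _
    (fun z => s ^- (n + k) * (f \_ (@unit_cube R n) \o pi) z)); last first.
  by move=> z /set_mem[_ /uvQ zQ]; rewrite /embed patchE mem_set.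
rewrite RintegralZl//; last first.
  apply: integrableS (integrable_base_proj u v intf) => //.
  exact: measurable_open_box.
rewrite {1}/Rintegral.
rewrite (@integral_base_proj u v A (EFin \o (f \_ (@unit_cube R n))))//.
rewrite fineM//; last first.
  apply: integrable_fin_num.
    by apply: measurableI => //; exact: measurable_open_box.
  apply: integrableS intf => //.
  by apply: measurableI => //; exact: measurable_open_box.
rewrite /= -/(Rintegral _ _ _) [in RHS]Rintegral_mkcondr mulrA; congr (_ * _).
rewrite /slab_vol exprD invfM mulrACA mulVf ?mul1r 1?mulrC//.
by rewrite expf_neq0// gt_eqF.
Qed.

End base_proj_integral.

(** * Integration along the fibers of the projection *)

Section fiber_integral.
Context {R : realType} (n k : nat) (q : 'rV[R]_(n + k)) (s : R).
Hypothesis s_gt0 : 0 < s.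
Local Notation pi := (base_proj q s).
Local Notation Q := (open_box q (q + const_mx s)).

(* [g] is the integral of [F] along the fibers of [pi] in [Q]; it is obtained
   as a Radon-Nikodym density, which spares Fubini's theorem. *)
Lemma fiber_integral_ex (Om : set 'rV[R]_(n + k)) F : measurable Om ->
  Q `<=` Om -> L1 Om F ->
  exists2 g, L1 (@unit_cube R n) g & forall A, measurable A ->
    \int[lebesgue_rV n]_(x in A) g x =
    \int[lebesgue_rV (n + k)]_(z in pi @^-1` A `&` Q) F z.
Proof.
move=> mOm QOm LF.
have mQ : measurable Q by exact: measurable_open_box.
have intF : (lebesgue_rV (n + k)).-integrable Q (EFin \o F).
  exact: integrableS LF.
have intFQ := (integrable_mkcond _ mQ).1 intF.
have mpiA A : measurable A -> measurable (pi @^-1` A).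
  by move=> mA; rewrite -[X in measurable X]setTI; exact: measurable_base_proj.
(* The image under the projection of the signed measure with density [F] on the cube. *)
pose nu : {charge set _ -> \bar R} :=
  measure_function_pushforward__canonical__charge_Charge
    (induced_charge intFQ) (measurable_base_proj q s).
have nuE A : nu A = (\int[lebesgue_rV (n + k)]_(z in pi @^-1` A `&` Q) (F z)%:E)%E.
  by rewrite /nu /= /pushforward /induced_charge integral_mkcondr.
(* By [lebesgue_rV_base_proj], the part of the cube above a null set is null. *)
have numu : nu `<< lebesgue_rV n.
  apply/null_content_dominatesP => A mA A0; rewrite nuE.
  apply: null_set_integral.
  - by apply: measurableI => //; exact: mpiA.
  - apply: measurable_funS (measurable_int _ intF) => //.
  - have mB := measurable_open_box (pi q) (pi (q + const_mx s)).
    have AB0 : lebesgue_rV n (A `&` open_box (pi q) (pi (q + const_mx s))) = 0%E.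
      by apply: subset_measure0 A0 => //; exact: measurableI.
    by rewrite [LHS](lebesgue_rV_base_proj q s_gt0 q _ mA) AB0 mule0.
have finh x := Radon_Nikodym_fin_num x numu.
have inth := Radon_Nikodym_integrable numu.
have hE : EFin \o (fine \o Radon_Nikodym nu (lebesgue_rV n)) =
    Radon_Nikodym nu (lebesgue_rV n).
  by apply/funext => x; rewrite /= fineK.
exists (fine \o Radon_Nikodym nu (lebesgue_rV n)) => [|A mA].
  rewrite /L1 /= hE; apply: integrableS inth => //.
  exact: measurable_unit_cube.
rewrite /Rintegral -nuE (Radon_Nikodym_integral numu mA); congr fine.
by apply: eq_integral => x _; rewrite -[RHS](congr1 (@^~ x) hE).
Qed.

End fiber_integral.

(** * Symmetric bases and the JF norm *)

Section one_symmetric.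
Context {R : realType} (X : normedModType R) (e : nat -> X).
Hypothesis sym_e : one_symmetric e.

(** The injection [i |-> nth 0 s i] extends to a permutation of the integers, to which symmetry
    applies with all signs equal to 1. *)
Lemma one_symmetric_seq (s : seq nat) (c : nat -> R) : uniq s ->
  `|\sum_(i <- s) c i *: e i| = `|\sum_(i < size s) c (nth 0%N s i) *: e i|.
Proof.
move=> us; pose m := (\max_(i <- s) i).+1.
(* Appending the missing indices below [m] turns [s] into a permutation of [0, ..., m - 1]; [pi] is
   the identity beyond. *)
pose t := s ++ [seq i <- iota 0 m | i \notin s].
have mem_t i : (i \in t) = (i < m)%N.
  rewrite mem_cat mem_filter mem_iota/= add0n.
  by case: (boolP (i \in s)) => //= si; rewrite ltnS leq_bigmax_seq.
have ut : uniq t.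
  rewrite cat_uniq us filter_uniq ?iota_uniq// andbT.
  by apply/hasPn => i; rewrite mem_filter => /andP[].
have size_t : size t = m.
  rewrite -(size_iota 0 m); apply/perm_size/uniq_perm => //.
    exact: iota_uniq.
  by move=> i; rewrite mem_t mem_iota.
pose pi i := if (i < m)%N then nth 0%N t i else i.
have pi_bij : bijective pi.
  exists (fun j => if (j < m)%N then index j t else j) => i; rewrite /pi.
    case: (boolP (i < m)%N) => im; last by rewrite (negbTE im).
    by rewrite -mem_t mem_nth ?size_t// index_uniq ?size_t.
  case: (boolP (i < m)%N) => im; last by rewrite (negbTE im).
  by rewrite -size_t index_mem mem_t im nth_index// mem_t.
rewrite -(sym_e (size s) (fun i => c (nth 0%N s i)) (fun=> or_introl erefl) pi_bij).
congr `|_|; rewrite (big_nth 0%N) big_mkord; apply: eq_bigr => i _.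
rewrite mul1r /pi ifT ?nth_cat ?ltn_ord//.
by rewrite -size_t size_cat ltn_addr.
Qed.

Lemma one_symmetric_set m (S : {set 'I_m}) (F : 'I_m -> R) :
  `|\sum_(j in S) F j *: e j| = `|\sum_(i < #|S|) F (enum_val i) *: e i|.
Proof.
pose c i := oapp F 0 (insub i).
have cE (j : 'I_m) : c j = F j by rewrite /c valK.
under eq_bigr do rewrite -cE.
rewrite -big_enum/= -(big_map val xpredT (fun i => c i *: e i)).
rewrite one_symmetric_seq; last by rewrite map_inj_uniq ?enum_uniq//; exact: val_inj.
rewrite size_map -cardE; congr `|_|; apply: eq_bigr => i _.
have x0 := enum_val i.
by rewrite -cE (nth_map x0) -?cardE// (enum_val_nth x0).
Qed.

Lemma one_symmetric_norm j : `|e j| = `|e 0%N|.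
Proof.
have := @one_symmetric_seq [:: j] (fun=> 1) isT.
by rewrite big_seq1 big_ord1 !scale1r.
Qed.

End one_symmetric.

Section JF_norm.
Context {R : realType} (X : completeNormedModType R) (e : nat -> X).
Hypothesis sym_e : one_symmetric e.
Variables (n : nat) (Om : set 'rV[R]_n).
Hypothesis mOm : measurable Om.

Lemma parallelepipeds_measurable (T : set 'rV[R]_n) :
  parallelepipeds Om T -> measurable T.
Proof. by move=> [a [b [_ -> _]]]; exact: measurable_open_box. Qed.

(** All [e j] have the norm of [e 0], so the triangle inequality and disjointness bound the sums by
    the norm of [f] in L1 times that of [e 0]. *)
Lemma JF_norm_has_ubound f : L1 Om f ->
  has_ubound [set r | exists (m : nat) (T : 'I_m -> set 'rV[R]_n),
    [/\ forall j, parallelepipeds Om (T j),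
        trivIset [set: 'I_m] T &
        r = `|\sum_(j < m) (\int[lebesgue_rV n]_(x in T j) f x) *: e j| ]].
Proof.
move=> Lf; exists (fine (\int[lebesgue_rV n]_(x in Om) `|(f x)%:E|)%E * `|e 0%N|).
move=> _ [m [T [T_par T_triv ->]]].
have mT j := parallelepipeds_measurable (T_par j).
have TOm j : T j `<=` Om by have [a [b []]] := T_par j.
have mf := measurable_int _ Lf.
apply: (le_trans (ler_norm_sum _ _ _)).
under eq_bigr do rewrite normrZ one_symmetric_norm//.
rewrite -mulr_suml ler_wpM2r// -lee_fin fineK; last first.
  by rewrite ge0_fin_numE ?integral_ge0//; case/integrableP: Lf.
rewrite -sumEFin; apply: (@le_trans _ _
    (\sum_(j < m) \int[lebesgue_rV n]_(x in T j) `|(f x)%:E|)%E).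
  apply: lee_sum => j _; rewrite EFin_normr_Rintegral//; last first.
    exact: (integrableS mOm (mT j) (TOm j) Lf).
  by apply: le_abse_integral => //; apply: (measurable_funS mOm (TOm j) mf).
have UOm : \big[setU/set0]_(j < m) T j `<=` Om.
  by rewrite -bigcup_seq; apply: bigcup_sub.
have mU : measurable (\big[setU/set0]_(j < m) T j) by exact: bigsetU_measurable.
have mabsf : measurable_fun Om (fun x => `|(f x)%:E|)%E.
  exact: measurableT_comp.
rewrite -ge0_integral_bigsetU//.
- by apply: ge0_subset_integral => //; exact: mabsf.
- exact: index_enum_uniq.
- exact: sub_trivIset T_triv.
- exact: measurable_funS mOm UOm mabsf.
Qed.

(** By symmetry, the selected boxes can be renumbered consecutively, which gives an admissible
    family. *)
Lemma JF_norm_ge_set f m (T : 'I_m -> set 'rV[R]_n) (S : {set 'I_m}) :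
  L1 Om f -> (forall j, j \in S -> parallelepipeds Om (T j)) ->
  trivIset [set` S] T ->
  `|\sum_(j in S) (\int[lebesgue_rV n]_(x in T j) f x) *: e j| <=
  JF_norm e Om f.
Proof.
move=> Lf T_par T_triv; rewrite one_symmetric_set//.
apply: sup_ubound; first exact: JF_norm_has_ubound.
exists #|S|, (fun i => T (enum_val i)); split=> //.
  by move=> i; apply: T_par; exact: enum_valP.
move=> i j _ _ Tij; apply: enum_val_inj; apply: T_triv => //=; exact: enum_valP.
Qed.

Lemma JF_norm_le f (M : R) :
  (forall m (T : 'I_m -> set 'rV[R]_n), (forall j, parallelepipeds Om (T j)) ->
    trivIset [set: 'I_m] T ->
    `|\sum_(j < m) (\int[lebesgue_rV n]_(x in T j) f x) *: e j| <= M) ->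
  JF_norm e Om f <= M.
Proof.
move=> fM; apply: ge_sup => [|_ [m [T [T_par T_triv ->]]]]; last exact: fM.
(* The empty family makes the set of the supremum nonempty. *)
exists `|\sum_(j < 0) (\int[lebesgue_rV n]_(x in set0) f x) *: e j|, 0%N.
exists (fun=> set0); split=> //; first by case.
by move=> [].
Qed.

End JF_norm.

(** * Averages over finitely many cells *)

Section convex_cells.
Context d (T : measurableType d) {R : realType} (V : normedModType R).
Variable mu : {measure set T -> \bar R}.

(* The points of [Y] lying in the same sets [U j] form finitely many cells, and
   the left-hand side is the average over the cells, weighted by their measure,
   of the sums bounded by [M]. *)
Lemma norm_weighted_sum_le (Y : set T) m (U : 'I_m -> set T) (x : 'I_m -> V)
    (M : R) :
  measurable Y -> (forall j, measurable (U j)) -> (forall j, U j `<=` Y) ->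
  (0 < mu Y < +oo)%E ->
  (forall y, Y y -> `|\sum_(j < m | `[< U j y >]) x j| <= M) ->
  `|\sum_(j < m) (fine (mu (U j)) / fine (mu Y)) *: x j| <= M.
Proof.
move=> mY mU UY /andP[Y0 Yoo] xM.
(* The cell of a point is determined by the set of indices [j] whose [U j] contains it. *)
pose sig y : {set 'I_m} := [set j | `[< U j y >]]%SET.
pose C (S : {set 'I_m}) := Y `&` [set y | sig y = S].
have mC S : measurable (C S).
  rewrite (_ : C S = Y `&` \bigcap_(j in [set: 'I_m])
      (if j \in S then U j else ~` U j)).
    apply: measurableI => //; apply: fin_bigcap_measurable => // j _.
    by case: ifP => _ //; exact: measurableC.
  apply/seteqP; split => [y [Yy <-]|y [Yy yS]]; split => //.
    by move=> j _; rewrite inE; case: asboolP.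
  by apply/setP => j; rewrite inE; have := yS j I; case: ifP => _ ?; apply/asboolP.
have C_triv D : trivIset setT (fun S => D `&` C S).
  by move=> S S' _ _ [y [[_ [_ <-]] [_ [_ <-]]]].
have muE A : measurable A -> A `<=` Y -> mu A = (\sum_S mu (A `&` C S))%E.
  move=> mA AY.
  rewrite -[in LHS](setIidl AY).
  rewrite (_ : Y = \bigcup_(S in [set` index_enum {set 'I_m}]) C S); last first.
    apply/seteqP; split=> [y Yy|y [S _ []//]]; exists (sig y) => //=.
    exact: mem_index_enum.
  rewrite setI_bigcupr measure_fin_bigcup//.
  - by rewrite -fsbig_seq ?index_enum_uniq.
  - exact: sub_trivIset (C_triv A).
  - by move=> S _; exact: measurableI.
have fin A : measurable A -> A `<=` Y -> mu A \is a fin_num.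
  move=> mA AY; rewrite ge0_fin_numE//; apply: le_lt_trans Yoo.
  by apply: le_measure => //; rewrite inE.
have Cfin S : mu (C S) \is a fin_num by apply: fin => // y [].
have fY : 0 < fine (mu Y) by rewrite fine_gt0// Y0.
have UE j : fine (mu (U j)) = \sum_(S : {set 'I_m} | j \in S) fine (mu (C S)).
  rewrite muE// -sum_fine; last first.
    by move=> S _; apply: fin => [|y [] /UY//]; exact: measurableI.
  rewrite [RHS]big_mkcond/=; apply: eq_bigr => S _; case: ifPn => jS.
    congr (fine (mu _)); apply/setIidPr => y [_ /= sy].
    by move: jS; rewrite -sy inE => /asboolP.
  rewrite (_ : _ `&` _ = set0) ?measure0//; rewrite -subset0 => y [Uy [_ /= sy]].
  by move: jS; rewrite -sy inE => /asboolP.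
have YE : fine (mu Y) = \sum_(S : {set 'I_m}) fine (mu (C S)).
  rewrite (muE Y)// -sum_fine; last first.
    by move=> S _; apply: fin => [|y []//]; exact: measurableI.
  by apply: eq_bigr => S _; congr (fine (mu _)); apply/setIidPr => y [].
rewrite (_ : \sum_(j < m) _ = \sum_(S : {set 'I_m})
    (fine (mu (C S)) / fine (mu Y)) *: \sum_(j in S) x j); last first.
  under eq_bigr do rewrite UE mulr_suml scaler_suml.
  rewrite (exchange_big_dep xpredT)//=; apply: eq_bigr => S _.
  by rewrite scaler_sumr.
apply: (le_trans (ler_norm_sum _ _ _)).
(* The weights of the cells add up to 1, so [M] is distributed over the cells. *)
rewrite -[leRHS]mul1r -(divff (lt0r_neq0 fY)) {2}YE -mulrA mulr_suml.
apply: ler_sum => S _; rewrite normrZ ger0_norm ?divr_ge0 ?fine_ge0//.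
rewrite mulrA.
(* An empty cell has weight 0; on a nonempty one the hypothesis at any of its points bounds the
   sum. *)
have [[y [Yy yS]]|CS0] := pselect (C S !=set0); last first.
  rewrite (_ : C S = set0) ?measure0 ?mul0r//.
  by rewrite -subset0 => y Cy; apply: CS0; exists y.
rewrite ler_wpM2l ?divr_ge0 ?fine_ge0//; apply: le_trans (xM y Yy).
rewrite le_eqVlt -yS; apply/orP; left; apply/eqP; congr `|_|.
by apply: eq_bigl => j; rewrite inE.
Qed.

End convex_cells.

(** * The embedding is isometric *)

Section JF_cube.
Context {R : realType} (X : completeNormedModType R) (e : nat -> X).
Hypothesis sym_e : one_symmetric e.
Variables (n k : nat) (q : 'rV[R]_(n + k)) (s : R).
Hypothesis s_gt0 : 0 < s.
Variable Om : set 'rV[R]_(n + k).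
Local Notation pi := (base_proj q s).
Local Notation Q := (open_box q (q + const_mx s)).
Hypotheses (mOm : measurable Om) (QOm : Q `<=` Om).

(** A point of the box forces the strict inequalities between corners that [parallelepipeds]
    requires. *)
Lemma nonempty_box_parallelepipeds m (A T : set 'rV[R]_m) :
  (exists a b, T = open_box a b) -> T !=set0 -> T `<=` A ->
  parallelepipeds A T.
Proof.
move=> [a [b ->]] [x abx] abA; exists a, b; split=> // i.
by have /andP[] := abx i; exact: lt_trans.
Qed.

(** The vector [row_mx (lsubmx q + s *: x) y] is the point with projection [x] and last coordinates
    [y]; in these coordinates a box is a product. *)
Lemma open_box_fiber u v x y :
  open_box u v (row_mx (lsubmx q + s *: x) y) <->
  open_box (pi u) (pi v) x /\ open_box (rsubmx u) (rsubmx v) y.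
Proof.
have E i : (pi u ord0 i < x ord0 i < pi v ord0 i) =
    (u ord0 (lshift k i) < (lsubmx q + s *: x) ord0 i < v ord0 (lshift k i)).
  rewrite !mxE !(mulrC s^-1) ltr_pdivrMr// ltr_pdivlMr// ltrBlDl ltrBrDl.
  by rewrite (mulrC s).
split=> [xy|[ux vy] i].
  split=> i; first by rewrite E; have := xy (lshift k i); rewrite row_mxEl.
  by have := xy (rshift n i); rewrite row_mxEr !mxE.
case: (splitP i) => j ij.
  have -> : i = lshift k j by exact: val_inj.
  by rewrite row_mxEl -E.
have -> : i = rshift n j by exact: val_inj.
by have := vy j; rewrite row_mxEr !mxE.
Qed.

Lemma base_proj_cube :
  open_box (pi q) (pi (q + const_mx s)) = @unit_cube R n.
Proof.
rewrite unit_cubeE; congr open_box; apply/rowP => i; rewrite !mxE.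
  by rewrite subrr mulr0.
by rewrite addrAC subrr add0r mulVf// gt_eqF.
Qed.

Lemma box_vol_cube :
  box_vol (rsubmx q) (rsubmx (q + const_mx s)) = s ^+ k.
Proof.
rewrite /box_vol -[k in RHS]card_ord -prodr_const; apply: eq_bigr => i _.
by rewrite !mxE addrAC subrr add0r max_r// ltW.
Qed.

(** Disjoint boxes of the unit cube lift to disjoint boxes of [Q], over which [F] has the same
    integrals as [g] below. *)
Lemma JF_norm_fiber_le F g : L1 Om F ->
  (forall A, measurable A -> A `<=` @unit_cube R n ->
    \int[lebesgue_rV n]_(x in A) g x =
    \int[lebesgue_rV (n + k)]_(z in pi @^-1` A `&` Q) F z) ->
  JF_norm e (@unit_cube R n) g <= JF_norm e Om F.
Proof.
move=> LF gF; apply: JF_norm_le => m T T_par T_triv.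
pose T' j := pi @^-1` (T j) `&` Q.
have Tcube j : T j `<=` @unit_cube R n by have [a [b []]] := T_par j.
rewrite (_ : \sum_(j < m) _ = \sum_(j in [set: 'I_m]%SET)
    (\int[lebesgue_rV (n + k)]_(z in T' j) F z) *: e j); last first.
  apply: eq_big => [j|j _]; first by rewrite inE.
  by rewrite gF//; exact: parallelepipeds_measurable.
apply: JF_norm_ge_set => // [j _|i j _ _ [z [[Tiz _] [Tjz _]]]]; last first.
  by apply: T_triv => //; exists (pi z).
have [a [b [ab Tab _]]] := T_par j.
apply: nonempty_box_parallelepipeds.
- by rewrite /T' Tab base_proj_open_box//; do 2 eexists.
(* The lifted box is nonempty: it contains the point above the center of [T j] and at the center of
   the fiber. *)
- pose x : 'rV[R]_n := \row_i ((a ord0 i + b ord0 i) / 2).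
  have Tx : T j x by rewrite Tab => i; rewrite mxE !midf_lt.
  exists (row_mx (lsubmx q + s *: x) (rsubmx q + const_mx (s / 2))).
  split; first by rewrite /= base_projK.
  apply/open_box_fiber; split; first by rewrite base_proj_cube; exact: Tcube Tx.
  move=> i; rewrite !mxE ltrDl divr_gt0//= ltrD2l.
  by rewrite ltr_pdivrMr// ltr_pMr// ltr1n.
- by move=> z [_ /QOm].
Qed.

(** For the whole of [Q] the relative volume of the fiber is 1. Thus fiber integration is a left
    inverse of the embedding. *)
Lemma embed_fiber f A : L1 (@unit_cube R n) f -> measurable A ->
  A `<=` @unit_cube R n ->
  \int[lebesgue_rV n]_(x in A) f x =
  \int[lebesgue_rV (n + k)]_(z in pi @^-1` A `&` Q) embed q s f z.
Proof.
move=> Lf mA Acube; rewrite integral_embed//.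
rewrite base_proj_cube -setIA setIid setIidl// box_vol_cube.
by rewrite divff ?mul1r// expf_neq0 ?gt_eqF.
Qed.

(** One inequality holds because [f] is the fiber integral of its embedding; the other is the
    averaging argument over [y]. *)
Lemma JF_norm_embed f : L1 (@unit_cube R n) f ->
  JF_norm e Om (embed q s f) = JF_norm e (@unit_cube R n) f.
Proof.
move=> Lf; apply/eqP; rewrite eq_le; apply/andP; split; last first.
  apply: JF_norm_fiber_le => [|A mA Acube]; first exact: L1_embed.
  exact: embed_fiber.
apply: JF_norm_le => m T T_par T_triv.
have /choice[a /choice[b Tab]] : forall j, exists a, exists b, T j = open_box a b.
  by move=> j; have [a [b [_ Tj _]]] := T_par j; exists a, b.
pose u j := map2_mx Num.max (a j) q.
pose v j := map2_mx Num.min (b j) (q + const_mx s).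
have TQ j : T j `&` Q = open_box (u j) (v j) by rewrite Tab open_boxI.
pose T' j := open_box (pi (u j)) (pi (v j)) `&` @unit_cube R n.
pose U j := open_box (rsubmx (u j)) (rsubmx (v j)).
pose Y := open_box (rsubmx q) (rsubmx (q + const_mx s)).
have volY : lebesgue_rV k Y = (s ^+ k)%:E.
  by rewrite lebesgue_rV_box_vol box_vol_cube.
have Yfin : (0 < lebesgue_rV k Y < +oo)%E.
  by rewrite volY lte_fin exprn_gt0//= ltry.
rewrite (_ : \sum_(j < m) _ = \sum_(j < m)
    (fine (lebesgue_rV k (U j)) / fine (lebesgue_rV k Y)) *:
      ((\int[lebesgue_rV n]_(x in T' j) f x) *: e j)); last first.
  apply: eq_bigr => j _; rewrite scalerA; congr (_ *: _).
  rewrite volY lebesgue_rV_box_vol /=.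
  (* The embedded function vanishes off [Q], so only the part of [T j] in [Q] counts. *)
  rewrite (_ : embed q s f = (embed q s f) \_ Q); last first.
    by apply/funext => z; rewrite /embed !patchE; case: ifP => //; rewrite mulr0.
  rewrite -Rintegral_mkcondr TQ -[open_box (u j) _]setTI -(preimage_setT pi).
  rewrite integral_embed// ?setTI//.
  by rewrite -TQ; exact: subIsetr.
apply: (@norm_weighted_sum_le _ _ _ _ (lebesgue_rV k) Y).
- exact: measurable_open_box.
- by move=> j; exact: measurable_open_box.
- move=> j y /= Uy i; have := Uy i; rewrite !mxE gt_max lt_min.
  by move=> /andP[/andP[_ ->] /andP[_ ->]].
- exact: Yfin.
(* Indices with empty [T' j] contribute 0 and are dropped, since an empty box is not in
   [parallelepipeds]. *)
move=> y Yy; pose S : {set 'I_m} := [set j | `[< U j y /\ T' j !=set0 >]]%SET.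
rewrite (_ : \sum_(j < m | _) _ = \sum_(j in S)
    (\int[lebesgue_rV n]_(x in T' j) f x) *: e j); last first.
  rewrite [LHS]big_mkcond [RHS]big_mkcond/=; apply: eq_bigr => j _.
  rewrite inE; have [T'0|/set0P/negP/negPn/eqP ->] := pselect (T' j !=set0).
    by congr (if _ then _ else _); apply: asbool_equiv_eq; split=> [|[]].
  by rewrite Rintegral_set0 scale0r !if_same.
apply: JF_norm_ge_set => //.
- exact: measurable_unit_cube.
- move=> j; rewrite inE => /asboolP[_ T'0]; apply: nonempty_box_parallelepipeds => //.
    by rewrite /T' unit_cubeE open_boxI; do 2 eexists.
  exact: subIsetr.
(* A common point [x] of [T' i] and [T' j] gives, together with [y], a common point of [T i] and
   [T j]. *)
- move=> i j; rewrite /= !inE => -[Ui _] [Uj _] [x [[xi _] [xj _]]].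
  apply: T_triv => //; exists (row_mx (lsubmx q + s *: x) y).
  have inT l : U l y -> open_box (pi (u l)) (pi (v l)) x ->
      T l (row_mx (lsubmx q + s *: x) y).
    move=> Uly xl; suff : (T l `&` Q) (row_mx (lsubmx q + s *: x) y) by case.
    by rewrite TQ; apply/open_box_fiber.
  by split; exact: inT.
Qed.

End JF_cube.

(** * Extension to the completions *)

Section dense_extension.
Context {R : realType} (V : normedModType R) (W : completeNormedModType R).

Lemma dense_norm (D : set V) v eps : dense D -> 0 < eps ->
  exists2 v', D v' & `|v - v'| < eps.
Proof.
move=> dD eps0; have [|v' [vv' Dv']] := dD (ball v eps) _ (ball_open v eps).
  by exists v; exact: ballxx.
by exists v' => //; move: vv'; rewrite -ball_normE.
Qed.

(** The map to extend is given by its graph, because a vector of the dense domain may come from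
    several functions; single-valuedness follows from linearity and the bound. *)
Variables (G : V -> W -> Prop) (C : R).
Hypothesis C_ge0 : 0 <= C.
Hypothesis G_lin : forall a v w v' w', G v w -> G v' w' ->
  G (a *: v + v') (a *: w + w').
Hypothesis G_bnd : forall v w, G v w -> `|w| <= C * `|v|.
Hypothesis G_dense : dense [set v | exists w, G v w].

(** The closure of the graph [G]. *)
Let H v w := forall eps, 0 < eps -> exists v' w',
  [/\ G v' w', `|v - v'| < eps & `|w - w'| < eps].

Let H_lin a v w v' w' : H v w -> H v' w' -> H (a *: v + v') (a *: w + w').
Proof.
move=> Hv Hv' eps eps0; have a0 : 0 < `|a| + 1 by rewrite ltr_wpDl.
(* Chosen so that [|a| * del + del = eps]. *)
pose del := eps / (`|a| + 1).
have del0 : 0 < del by rewrite divr_gt0.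
have [x [y [Gxy vx wy]]] := Hv _ del0; have [x' [y' [Gxy' vx' wy']]] := Hv' _ del0.
have est (U : normedModType R) (b c b' c' : U) : `|b - c| < del ->
    `|b' - c'| < del -> `|(a *: b + b') - (a *: c + c')| < eps.
  move=> bc bc'; rewrite opprD addrACA -scalerBr.
  rewrite (le_lt_trans (ler_normD _ _))// normrZ.
  rewrite (_ : eps = `|a| * del + del); last first.
    by rewrite -[X in _ + X]mul1r -mulrDl mulrC divfK// gt_eqF.
  by rewrite ler_ltD// ler_wpM2l// ltW.
by exists (a *: x + x'), (a *: y + y'); split; [exact: G_lin|exact: est|exact: est].
Qed.

Let H_bnd v w : H v w -> `|w| <= C * `|v|.
Proof.
move=> Hv; apply/ler_addgt0Pr => eps eps0.
(* An approximation within [eps / (C + 1)] costs this amount once for [w] and [C] times for [v], in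
   total [eps]. *)
have C0 : 0 < C + 1 by rewrite ltr_wpDl.
have [x [y [Gxy vx wy]]] := Hv _ (divr_gt0 eps0 C0).
rewrite -[w](subrK y) (le_trans (ler_normD _ _))//.
rewrite (_ : eps = eps / (C + 1) + C * (eps / (C + 1))); last first.
  by rewrite -[X in X + _]mul1r -mulrDl addrC mulrC divfK// gt_eqF.
rewrite addrCA lerD//; first exact: ltW.
rewrite (le_trans (G_bnd Gxy))// -mulrDr ler_wpM2l//.
by rewrite -[x](subKr v) (le_trans (ler_normB _ _))// lerD2l ltW.
Qed.

(** The difference of two values at [v] is a value at 0, hence 0 by the bound. *)
Let H_fun v w w' : H v w -> H v w' -> w = w'.
Proof.
move=> Hw Hw'; have := H_bnd (H_lin (-1) Hw' Hw).
rewrite !scaleN1r addNr normr0 mulr0 normr_le0 addrC subr_eq0 => /eqP.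
by [].
Qed.

(** Values of [G] at points converging to [v] form a Cauchy sequence by the bound, and [W] is
    complete. *)
Let H_total v : exists w, H v w.
Proof.
have /choice[p pP] : forall n, exists p : V * W, G p.1 p.2 /\ `|v - p.1| < n.+1%:R^-1.
  move=> n; have n0 : 0 < n.+1%:R^-1 :> R by rewrite invr_gt0.
  by have [x [y Gxy] vx] := dense_norm v G_dense n0; exists (x, y).
pose y n := (p n).2.
have y_est n m : `|y n - y m| <= C * (n.+1%:R^-1 + m.+1%:R^-1).
  have := G_bnd (G_lin (-1) (pP m).1 (pP n).1).
  rewrite !scaleN1r ![- _ + _]addrC => /le_trans; apply.
  rewrite ler_wpM2l// (_ : (p n).1 - (p m).1 = (v - (p m).1) - (v - (p n).1)).
    rewrite (le_trans (ler_normB _ _))// [leRHS]addrC.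
    by rewrite lerD// ltW//; [case: (pP m)|case: (pP n)].
  by rewrite opprB [RHS]addrC addrA subrK.
have /cauchy_exP/cauchy_cvgP/cvg_ex[w yw] : cauchy_ex (y @ \oo).
  move=> eps eps0; have C0 : 0 < C + 1 by rewrite ltr_wpDl.
  have del0 : 0 < eps / (C + 1) / 2 by rewrite !divr_gt0.
  have [N _ NP] := near_infty_natSinv_lt (PosNum del0).
  exists (y N), N => // n /= Nn; rewrite -ball_normE /ball_/=.
  apply: le_lt_trans (y_est _ _) _.
  have lt2 : N.+1%:R^-1 + n.+1%:R^-1 < eps / (C + 1).
    by rewrite [ltRHS]splitr ltrD//; [exact: (NP N (leqnn N))|exact: NP].
  apply: (@le_lt_trans _ _ (C * (eps / (C + 1)))).
    by rewrite ler_wpM2l// ltW.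
  by rewrite mulrCA gtr_pMr// ltr_pdivrMr// mul1r ltrDl.
exists w => eps eps0; move/cvgrPdist_lt : yw => /(_ _ eps0) yw.
have [n [wn vn]] := filter_ex (filterI yw (near_infty_natSinv_lt (PosNum eps0))).
by exists (p n).1, (y n); have [Gp vp] := pP n; split=> //; exact: lt_trans vn.
Qed.

Lemma dense_extension : exists T : {linear V -> W},
  (forall v w, G v w -> T v = w) /\ (forall v, `|T v| <= C * `|v|).
Proof.
have /choice[T TP] := H_total.
pose Tlin := GRing.isLinear.Build R V W *:%R T
  (fun a u v => H_fun (TP (a *: u + v)) (H_lin a (TP u) (TP v))).
pose TL : {linear V -> W} := HB.pack T Tlin.
exists TL; split=> [v w Gvw|v]; last exact: H_bnd (TP v).
apply: H_fun (TP v) _ => eps eps0.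
by exists v, w; rewrite !subrr !normr0.
Qed.

End dense_extension.

(** * The complemented isometric copy *)

Lemma L1_lin {R : realType} n (Om : set 'rV[R]_n) (a : R) f g : measurable Om ->
  L1 Om f -> L1 Om g -> L1 Om (fun x => a * f x + g x).
Proof.
by move=> mOm Lf Lg; exact: (integrableD mOm (integrableZl mOm a Lf) Lg).
Qed.

Lemma Rintegral_lin {R : realType} n (Om A : set 'rV[R]_n) (a : R) f g :
  measurable Om -> measurable A -> A `<=` Om -> L1 Om f -> L1 Om g ->
  \int[lebesgue_rV n]_(x in A) (a * f x + g x) =
  a * \int[lebesgue_rV n]_(x in A) f x + \int[lebesgue_rV n]_(x in A) g x.
Proof.
move=> mOm mA AOm Lf Lg.
have Lf' := integrableS mOm mA AOm Lf; have Lg' := integrableS mOm mA AOm Lg.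
rewrite (RintegralD mA (f1 := fun x => a * f x) _ Lg') ?RintegralZl//.
exact: (integrableZl mA a Lf').
Qed.

(** Balls are cubes in the sup norm; the one around [q] of radius [s] contains the cube of side [s]
    with lower corner [q]. *)
Lemma open_has_cube {R : realType} n (Om : set 'rV[R]_n) : Om !=set0 -> open Om ->
  exists q s, 0 < s /\ open_box q (q + const_mx s) `<=` Om.
Proof.
move=> [q Omq] oOm.
have /nbhs_ballP[s s0 sOm] : nbhs q Om by exact: open_nbhs_nbhs.
exists q, s; split=> // x qx; apply: sOm; split=> // i j; rewrite !ord1 /ball/=.
have := qx j; rewrite !mxE => /andP[x1 x2].
by rewrite distrC ltr_distl ltrBlDr x2 (lt_trans x1)// ltrDl.
Qed.

Theorem theorem4p1 (R : realType) (X : completeNormedModType R) (e : nat -> X)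
  (d0 d1 : nat) (Om : set 'rV[R]_d1) (J0 J1 : completeNormedModType R)
  (reflX : reflexive_space X) (basis_e : one_symmetric_basis e)
  (d0_ge1 : (1 <= d0)%N) (d0_le_d1 : (d0 <= d1)%N)
  (Om_neq0 : Om !=set0) (Om_bounded : bounded_set Om) (Om_open : open Om)
  (J0_JF : is_JF e (@unit_cube R d0) J0) (J1_JF : is_JF e Om J1) :
  isometric_to_complemented J0 J1.
Proof.
have [_ sym_e] := basis_e.
have [k d1E] : exists k, d1 = (d0 + k)%N by exists (d1 - d0)%N; rewrite subnKC.
move: Om Om_neq0 Om_open J1_JF {Om_bounded d0_le_d1}; rewrite {d1}d1E.
move=> Om Om_neq0 Om_open [i1 [i1_lin i1_norm i1_dense]].
have [i0 [i0_lin i0_norm i0_dense]] := J0_JF.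
have mOm := open_rV_measurable Om_open.
have mcube := @measurable_unit_cube R d0.
have [q [s [s_gt0 QOm]]] := open_has_cube Om_neq0 Om_open.
pose fibers F g := forall A, measurable A -> A `<=` @unit_cube R d0 ->
  \int[lebesgue_rV d0]_(x in A) g x =
  \int[lebesgue_rV (d0 + k)]_(z in base_proj q s @^-1` A `&`
    open_box q (q + const_mx s)) F z.
(* [T] extends the embedding of functions. *)
have [T [TE T_le]] : exists T : {linear J0 -> J1},
    (forall f, L1 (@unit_cube R d0) f -> T (i0 f) = i1 (embed q s f)) /\
    (forall v, `|T v| <= 1 * `|v|).
  have [||||T [TG T_le]] := @dense_extension _ J0 J1
    (fun v w => exists2 f, L1 (@unit_cube R d0) f &
      v = i0 f /\ w = i1 (embed q s f)) 1.
  - exact: ler01.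
  - move=> a _ _ _ _ [f Lf [-> ->]] [g Lg [-> ->]].
    exists (fun x => a * f x + g x); first exact: L1_lin.
    by rewrite embed_lin i0_lin// i1_lin//; exact: L1_embed.
  - move=> _ _ [f Lf [-> ->]].
    rewrite mul1r i0_norm// i1_norm; last exact: L1_embed.
    by rewrite JF_norm_embed.
  - move=> O O0 /i0_dense -/(_ O0)[v [Ov [f Lf fv]]].
    by exists v; split=> //; exists (i1 (embed q s f)), f.
  - by exists T; split=> // f Lf; apply: TG; exists f.
(* [P] extends fiber integration; its graph is dense in the domain since every [F] in L1 has a fiber
   integral. *)
have [P [PE P_le]] : exists P : {linear J1 -> J0},
    (forall F g, L1 Om F -> L1 (@unit_cube R d0) g -> fibers F g ->
      P (i1 F) = i0 g) /\
    (forall w, `|P w| <= 1 * `|w|).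
  have [||||P [PG P_le]] := @dense_extension _ J1 J0
    (fun w v => exists F g, [/\ L1 Om F, L1 (@unit_cube R d0) g, fibers F g,
      w = i1 F & v = i0 g]) 1.
  - exact: ler01.
  - move=> a _ _ _ _ [F [g [LF Lg Fg -> ->]]] [F' [g' [LF' Lg' Fg' -> ->]]].
    exists (fun x => a * F x + F' x), (fun x => a * g x + g' x).
    split; [exact: L1_lin|exact: L1_lin| |by rewrite i1_lin|by rewrite i0_lin].
    move=> A mA Acube; rewrite (Rintegral_lin _ mcube)// Fg// Fg'//.
    rewrite (Rintegral_lin _ mOm)//; last by move=> z [_ /QOm].
    apply: measurableI; last exact: measurable_open_box.
    by rewrite -[X in measurable X]setTI; exact: measurable_base_proj.
  - move=> _ _ [F [g [LF Lg Fg -> ->]]]; rewrite mul1r i0_norm// i1_norm//.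
    exact: (JF_norm_fiber_le sym_e s_gt0 mOm QOm LF Fg).
  - move=> O O0 /i1_dense -/(_ O0)[w [Ow [F LF Fw]]].
    have [g Lg Fg] := fiber_integral_ex s_gt0 mOm QOm LF.
    by exists w; split=> //; exists (i0 g), F, g; split=> // A mA _; exact: Fg.
  - by exists P; split=> // F g LF Lg Fg; apply: PG; exists F, g.
(* This holds on the dense image of L1 by [embed_fiber]; both maps are contractions, so an
   approximation within [eps / 2] suffices. *)
have PT v : P (T v) = v.
  apply/eqP; rewrite -subr_eq0 -normr_le0; apply/ler_addgt0Pr => eps eps0.
  have [_ [f Lf <-] vf] := dense_norm v i0_dense (divr_gt0 eps0 (ltr0n R 2)).
  have PTf : P (T (i0 f)) = i0 f.
    rewrite TE//; apply: PE => //; first exact: L1_embed.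
    by move=> A mA Acube; exact: embed_fiber.
  rewrite add0r (_ : P (T v) - v = P (T (v - i0 f)) - (v - i0 f)).
    rewrite (le_trans (ler_normB _ _))// [leRHS]splitr lerD//; last exact: ltW.
    apply: le_trans (P_le _) _; rewrite mul1r; apply: le_trans (T_le _) _.
    by rewrite mul1r ltW.
  by rewrite (linearB T) (linearB P) PTf opprB addrA subrK.
(* As [P] is a left inverse of [T], the composite is idempotent with the range of [T]; [T] is
   isometric because [|v| = |P (T v)| <= |T v| <= |v|]. *)
exists T, (T \o P : {linear J1 -> J1}); split.
- move=> v; apply/eqP; rewrite eq_le -{1}[`|v|]mul1r T_le/= -{1}(PT v).
  by rewrite -[leRHS]mul1r P_le.
- exists 1 => w; apply: le_trans (T_le _) _.
  by rewrite mul1r P_le.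
- by move=> w; rewrite /= PT.
- apply/seteqP; split=> [_ [w _ <-]|_ [v _ <-]]; first by exists (P w).
  by exists (T v) => //=; rewrite PT.
Qed.
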